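(* Let $\mathcal{K}$ be the class of all contexts. If a sequent $\alpha\vdash\beta$ is valid in $\mathcal{K}$, then $\alpha\vdash\beta$ is provable in $\mathbf{CDBL}$.
   Context: **Contexts and protoconcepts.** A context is $\mathbb{K}=(G,M,I)$ with $G,M$ sets and $I\subseteq G\times M$. For $A\subseteq G$, $A':=\{m\in M: gIm\text{ for all }g\in A\}$; for $B\subseteq M$, $B':=\{g\in G: gIm\text{ for all }m\in B\}$. A protoconcept of $\mathbb{K}$ is a pair $(A,B)$, $A\subseteq G$, $B\subseteq M$, with $A''=B'$ (equivalently $A'=B''$); $\mathfrak{P}(\mathbb{K})$ is the set of protoconcepts, ordered by $(A,B)\sqsubseteq(C,D)$ iff $A\subseteq C$ and $D\subseteq B$. Operations on $\mathfrak{P}(\mathbb{K})$: $(A_1,B_1)\sqcap(A_2,B_2):=(A_1\cap A_2,(A_1\cap A_2)')$, $(A_1,B_1)\sqcup(A_2,B_2):=((B_1\cap B_2)',B_1\cap B_2)$, $\neg(A,B):=(G\setminus A,(G\setminus A)')$, $\lrcorner(A,B):=((M\setminus B)',M\setminus B)$, $\top:=(G,\emptyset)$, $\bot:=(\emptyset,M)$. **The logic CDBL.** Formulae (set $\mathfrak{F}$) are generated from a countably infinite set $\mathbf{PV}$ of propositional variables and constants $\top,\bot$ by binary connectives $\sqcup,\sqcap$ and unary connectives $\neg,\lrcorner$. Abbreviations: $\alpha\vee\beta:=\neg(\neg\alpha\sqcap\neg\beta)$, $\alpha\wedge\beta:=\lrcorner(\lrcorner\alpha\sqcup\lrcorner\beta)$.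 A sequent is a pair of formulae, written $\alpha\vdash\beta$; $\alpha\dashv\vdash\beta$ stands for both $\alpha\vdash\beta$ and $\beta\vdash\alpha$. Axiom schemata: (1) $\alpha\vdash\alpha$; (2a) $\alpha\sqcap\beta\vdash\alpha$; (2b) $\alpha\vdash\alpha\sqcup\beta$; (3a) $\alpha\sqcap\beta\vdash\beta$; (3b) $\beta\vdash\alpha\sqcup\beta$; (4a) $\alpha\sqcap\beta\vdash(\alpha\sqcap\beta)\sqcap(\alpha\sqcap\beta)$; (4b) $(\alpha\sqcup\beta)\sqcup(\alpha\sqcup\beta)\vdash\alpha\sqcup\beta$; (5a) $\neg(\alpha\sqcap\alpha)\vdash\neg\alpha$; (5b) $\lrcorner\alpha\vdash\lrcorner(\alpha\sqcup\alpha)$; (6a) $\alpha\sqcap\neg\alpha\vdash\bot$; (6b) $\top\vdash\alpha\sqcup\lrcorner\alpha$; (7a) $\neg\neg(\alpha\sqcap\beta)\dashv\vdash\alpha\sqcap\beta$; (7b) $\lrcorner\lrcorner(\alpha\sqcup\beta)\dashv\vdash\alpha\sqcup\beta$; (8a) $\alpha\sqcap\alpha\vdash\alpha\sqcap(\alpha\sqcup\beta)$; (8b) $\alpha\sqcup(\alpha\sqcap\beta)\vdash\alpha\sqcup\alpha$; (9a) $\alpha\sqcap\alpha\vdash\alpha\sqcap(\alpha\vee\beta)$; (9b) $\alpha\sqcup(\alpha\wedge\beta)\vdash\alpha\sqcup\alpha$; (10a) $\alpha\sqcap(\beta\vee\gamma)\dashv\vdash(\alpha\sqcap\beta)\vee(\alpha\sqcap\gamma)$;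 (10b) $\alpha\sqcup(\beta\wedge\gamma)\dashv\vdash(\alpha\sqcup\beta)\wedge(\alpha\sqcup\gamma)$; (11a) $\bot\vdash\alpha$; (11b) $\alpha\vdash\top$; (12a) $\neg\top\vdash\bot$; (12b) $\top\vdash\lrcorner\bot$; (13a) $\neg\bot\dashv\vdash\top\sqcap\top$; (13b) $\lrcorner\top\dashv\vdash\bot\sqcup\bot$; (14) $(\alpha\sqcup\alpha)\sqcap(\alpha\sqcup\alpha)\dashv\vdash(\alpha\sqcap\alpha)\sqcup(\alpha\sqcap\alpha)$. Rules: from $\alpha\vdash\beta$ infer (R1) $\alpha\sqcap\gamma\vdash\beta\sqcap\gamma$, (R1)$'$ $\gamma\sqcap\alpha\vdash\gamma\sqcap\beta$, (R2) $\alpha\sqcup\gamma\vdash\beta\sqcup\gamma$, (R2)$'$ $\gamma\sqcup\alpha\vdash\gamma\sqcup\beta$, (R3) $\neg\beta\vdash\neg\alpha$, (R3)$'$ $\lrcorner\beta\vdash\lrcorner\alpha$; (R4) from $\alpha\vdash\beta$ and $\beta\vdash\gamma$ infer $\alpha\vdash\gamma$; (R5) from $\alpha\sqcap\beta\vdash\alpha\sqcap\alpha$, $\alpha\sqcap\alpha\vdash\alpha\sqcap\beta$, $\alpha\sqcup\beta\vdash\beta\sqcup\beta$ and $\beta\sqcup\beta\vdash\alpha\sqcup\beta$ infer $\alpha\vdash\beta$. A sequent is provable if it is the last member of a finite sequence of sequents, each an axiom or obtained from earlier ones by a rule. **Protoconcept semantics.** For a context $\mathbb{K}=(G,M,I)$,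 a valuation is a map $v:\mathfrak{F}\to\mathfrak{P}(\mathbb{K})$ commuting with $\sqcup,\sqcap,\neg,\lrcorner$ and with $v(\top)=(G,\emptyset)$, $v(\bot)=(\emptyset,M)$. A model based on $\mathbb{K}$ is a pair $(\mathfrak{P}(\mathbb{K}),v)$ with $v$ a valuation. $\alpha\vdash\beta$ is satisfied in this model if $v(\alpha)\sqsubseteq v(\beta)$; it is true in $\mathbb{K}$ if satisfied in every model based on $\mathbb{K}$; it is valid in $\mathcal{K}$ if true in every context $\mathbb{K}\in\mathcal{K}$. *)

(* Defs.v *)
(* MathComp; subsets are the classical sets of MathComp-Analysis. *)
From Stdlib Require List.
From mathcomp Require Import all_boot.
From mathcomp Require Import boolp classical_sets.

Set Implicit Arguments.
Unset Strict Implicit.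
Unset Printing Implicit Defensive.

Local Open Scope classical_set_scope.

Record context := Context {
  object : Type;
  attribute : Type;
  incidence : object -> attribute -> Prop }.

Section Protoconcepts.
Variable K : context.
Local Notation G := (object K).
Local Notation M := (attribute K).

(* The two derivation operators, both written with a prime on paper. *)
Definition common_attributes (A : set G) : set M :=
  [set m | forall g, A g -> incidence g m].
Definition common_objects (B : set M) : set G :=
  [set g | forall m, B m -> incidence g m].

Local Notation "A ^up" := (common_attributes A)
  (at level 2, left associativity, format "A ^up").
Local Notation "B ^dn" := (common_objects B)
  (at level 2, left associativity, format "B ^dn").

Lemma common_objectsK (B : set M) : B^dn^up^dn = B^dn.
Proof.
apply/seteqP; split=> g /= Hg m Hm; first by apply: Hg => h; apply.
exact: Hm.
Qed.

Record protoconcept := Protoconcept {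
  extent : set G;
  intent : set M;
  protoconceptP : extent^up^dn = intent^dn }.

Definition pc_le (x y : protoconcept) : Prop :=
  extent x `<=` extent y /\ intent y `<=` intent x.

Definition pc_of_objects (A : set G) : protoconcept :=
  @Protoconcept A A^up erefl.

Definition pc_of_attributes (B : set M) : protoconcept :=
  @Protoconcept B^dn B (common_objectsK B).

Definition pc_meet (x y : protoconcept) : protoconcept :=
  pc_of_objects (extent x `&` extent y).
Definition pc_join (x y : protoconcept) : protoconcept :=
  pc_of_attributes (intent x `&` intent y).
Definition pc_neg (x : protoconcept) : protoconcept :=
  pc_of_objects (~` extent x).
Definition pc_opp (x : protoconcept) : protoconcept :=
  pc_of_attributes (~` intent x).

Lemma pc_top_subproof : (@setT G)^up^dn = (@set0 M)^dn.
Proof. by apply/seteqP; split=> g _ m // Hm; apply: Hm. Qed.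

Lemma pc_bot_subproof : (@set0 G)^up^dn = (@setT M)^dn.
Proof. by apply/seteqP; split=> g Hg m Hm; apply: Hg => // h []. Qed.

Definition pc_top : protoconcept := Protoconcept pc_top_subproof.
Definition pc_bot : protoconcept := Protoconcept pc_bot_subproof.

End Protoconcepts.

Declare Scope cdbl_scope.
Delimit Scope cdbl_scope with cdbl.

Inductive formula : Type :=
  | Var of nat
  | Top
  | Bot
  | Join of formula & formula
  | Meet of formula & formula
  | Neg of formula
  | Opp of formula.

Bind Scope cdbl_scope with formula.

Notation "⊤" := Top (at level 0) : cdbl_scope.
Notation "⊥" := Bot (at level 0) : cdbl_scope.
Notation "a ⊔ b" := (Join a b) (at level 50, left associativity) : cdbl_scope.
Notation "a ⊓ b" := (Meet a b) (at level 50, left associativity) : cdbl_scope.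
Notation "¬ a" := (Neg a) (at level 35, right associativity) : cdbl_scope.
Notation "⌟ a" := (Opp a) (at level 35, right associativity) : cdbl_scope.

Local Open Scope cdbl_scope.

(* The connectives ∨ and ∧ are abbreviations and differ from ⊔ and ⊓. *)
Definition Vee (a b : formula) : formula := ¬ (¬ a ⊓ ¬ b).
Definition Wedge (a b : formula) : formula := ⌟ (⌟ a ⊔ ⌟ b).
Notation "a ∨ b" := (Vee a b) (at level 50, left associativity) : cdbl_scope.
Notation "a ∧ b" := (Wedge a b) (at level 50, left associativity) : cdbl_scope.

Definition sequent : Type := (formula * formula)%type.
Notation "a ⊢ b" := ((a, b) : sequent) (at level 70, no associativity)
  : cdbl_scope.

(* Each schema stated with ⊣⊢ is split into its two directions. *)
Inductive cdbl_axiom : sequent -> Prop :=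
  | ax1 a : cdbl_axiom (a ⊢ a)
  | ax2a a b : cdbl_axiom (a ⊓ b ⊢ a)
  | ax2b a b : cdbl_axiom (a ⊢ a ⊔ b)
  | ax3a a b : cdbl_axiom (a ⊓ b ⊢ b)
  | ax3b a b : cdbl_axiom (b ⊢ a ⊔ b)
  | ax4a a b : cdbl_axiom (a ⊓ b ⊢ (a ⊓ b) ⊓ (a ⊓ b))
  | ax4b a b : cdbl_axiom ((a ⊔ b) ⊔ (a ⊔ b) ⊢ a ⊔ b)
  | ax5a a : cdbl_axiom (¬ (a ⊓ a) ⊢ ¬ a)
  | ax5b a : cdbl_axiom (⌟ a ⊢ ⌟ (a ⊔ a))
  | ax6a a : cdbl_axiom (a ⊓ ¬ a ⊢ ⊥)
  | ax6b a : cdbl_axiom (⊤ ⊢ a ⊔ ⌟ a)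
  | ax7a_l a b : cdbl_axiom (¬ ¬ (a ⊓ b) ⊢ a ⊓ b)
  | ax7a_r a b : cdbl_axiom (a ⊓ b ⊢ ¬ ¬ (a ⊓ b))
  | ax7b_l a b : cdbl_axiom (⌟ ⌟ (a ⊔ b) ⊢ a ⊔ b)
  | ax7b_r a b : cdbl_axiom (a ⊔ b ⊢ ⌟ ⌟ (a ⊔ b))
  | ax8a a b : cdbl_axiom (a ⊓ a ⊢ a ⊓ (a ⊔ b))
  | ax8b a b : cdbl_axiom (a ⊔ (a ⊓ b) ⊢ a ⊔ a)
  | ax9a a b : cdbl_axiom (a ⊓ a ⊢ a ⊓ (a ∨ b))
  | ax9b a b : cdbl_axiom (a ⊔ (a ∧ b) ⊢ a ⊔ a)
  | ax10a_l a b c : cdbl_axiom (a ⊓ (b ∨ c) ⊢ (a ⊓ b) ∨ (a ⊓ c))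
  | ax10a_r a b c : cdbl_axiom ((a ⊓ b) ∨ (a ⊓ c) ⊢ a ⊓ (b ∨ c))
  | ax10b_l a b c : cdbl_axiom (a ⊔ (b ∧ c) ⊢ (a ⊔ b) ∧ (a ⊔ c))
  | ax10b_r a b c : cdbl_axiom ((a ⊔ b) ∧ (a ⊔ c) ⊢ a ⊔ (b ∧ c))
  | ax11a a : cdbl_axiom (⊥ ⊢ a)
  | ax11b a : cdbl_axiom (a ⊢ ⊤)
  | ax12a : cdbl_axiom (¬ ⊤ ⊢ ⊥)
  | ax12b : cdbl_axiom (⊤ ⊢ ⌟ ⊥)
  | ax13a_l : cdbl_axiom (¬ ⊥ ⊢ ⊤ ⊓ ⊤)
  | ax13a_r : cdbl_axiom (⊤ ⊓ ⊤ ⊢ ¬ ⊥)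
  | ax13b_l : cdbl_axiom (⌟ ⊤ ⊢ ⊥ ⊔ ⊥)
  | ax13b_r : cdbl_axiom (⊥ ⊔ ⊥ ⊢ ⌟ ⊤)
  | ax14_l a : cdbl_axiom ((a ⊔ a) ⊓ (a ⊔ a) ⊢ (a ⊓ a) ⊔ (a ⊓ a))
  | ax14_r a : cdbl_axiom ((a ⊓ a) ⊔ (a ⊓ a) ⊢ (a ⊔ a) ⊓ (a ⊔ a)).

(* The first argument lists the premises, the second is the conclusion. *)
Inductive cdbl_rule : seq sequent -> sequent -> Prop :=
  | R1 a b c : cdbl_rule [:: a ⊢ b] (a ⊓ c ⊢ b ⊓ c)
  | R1' a b c : cdbl_rule [:: a ⊢ b] (c ⊓ a ⊢ c ⊓ b)
  | R2 a b c : cdbl_rule [:: a ⊢ b] (a ⊔ c ⊢ b ⊔ c)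
  | R2' a b c : cdbl_rule [:: a ⊢ b] (c ⊔ a ⊢ c ⊔ b)
  | R3 a b : cdbl_rule [:: a ⊢ b] (¬ b ⊢ ¬ a)
  | R3' a b : cdbl_rule [:: a ⊢ b] (⌟ b ⊢ ⌟ a)
  | R4 a b c : cdbl_rule [:: a ⊢ b; b ⊢ c] (a ⊢ c)
  | R5 a b : cdbl_rule [:: a ⊓ b ⊢ a ⊓ a; a ⊓ a ⊢ a ⊓ b;
                           a ⊔ b ⊢ b ⊔ b; b ⊔ b ⊢ a ⊔ b] (a ⊢ b).

Definition cdbl_derivation (s : seq sequent) : Prop :=
  forall i c, onth s i = Some c ->
    cdbl_axiom c \/
    exists2 ps, cdbl_rule ps c &
      forall p, List.In p ps -> exists2 j, j < i & onth s j = Some p.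

Definition provable (c : sequent) : Prop :=
  exists s : seq sequent, cdbl_derivation (rcons s c).

Record valuation (K : context) := Valuation {
  val_of :> formula -> protoconcept K;
  val_join : forall a b, val_of (a ⊔ b) = pc_join (val_of a) (val_of b);
  val_meet : forall a b, val_of (a ⊓ b) = pc_meet (val_of a) (val_of b);
  val_neg : forall a, val_of (¬ a) = pc_neg (val_of a);
  val_opp : forall a, val_of (⌟ a) = pc_opp (val_of a);
  val_top : val_of ⊤ = pc_top K;
  val_bot : val_of ⊥ = pc_bot K }.

(* A model based on K is determined by its valuation. *)
Definition satisfied (K : context) (v : valuation K) (c : sequent) : Prop :=
  pc_le (v c.1) (v c.2).

Definition true_in (K : context) (c : sequent) : Prop :=
  forall v : valuation K, satisfied v c.

Definition valid_in (KK : set context) (c : sequent) : Prop :=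
  forall K, KK K -> true_in K c.

(* Main.v *)
Require Import Defs.
From Stdlib Require List.
From mathcomp Require Import all_boot.
From mathcomp Require Import boolp classical_sets.

(** The proof is the algebraic one: order formulae by provability and represent
    the resulting double Boolean algebra inside one protoconcept algebra.

    The canonical context has as objects the primary filters of formulae
    (proper filters containing [x] or [¬ x] for every [x]) and as attributes
    the primary ideals (dually, with [⌟]); a filter is incident to an ideal
    when they share a formula. The canonical valuation sends [x] to the pair of
    the set of filters containing [x] and the set of ideals containing [x].

    The meet half and the join half of the calculus are mirror images, so the
    filter theory is developed once, for an abstract [half_algebra], and used
    twice: for provability with [⊓], [¬], and for reversed provability with
    [⊔], [⌟]. Its key result is the separation lemma
    [primary_filter_separation]: for a directed lower set [J] without [a ⊓ a],
    some primary filter contains [a] and avoids [J]. Applied to a primary ideal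
    as [J], it computes the derivation operators: the ideals incident to every
    filter containing [x] are exactly those containing [x ⊓ x], and dually with
    [x ⊔ x]. Axiom (14) then yields the protoconcept condition, and that the
    valuation respects the connectives follows from [x ⊓ y] and [¬ x] being
    idempotent for [⊓], dually [x ⊔ y] and [⌟ x] for [⊔].

    Applied to the formulae below [b], separation shows that if every
    primary filter containing [a] contains [b], then [a ⊓ a ⊢ b] is provable;
    dually, if every primary ideal containing [b] contains [a], then
    [a ⊢ b ⊔ b] is provable. If [a ⊢ b] holds in the canonical model, both
    hold, and they are what rule (R5) needs to conclude [a ⊢ b]. *)

Local Open Scope classical_set_scope.
Local Open Scope cdbl_scope.

(** * Primary filters *)

Set Implicit Arguments.

(** One half of a double Boolean algebra, over a preorder. The other half
    enters only through the directedness of the sets that filters have to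
    avoid, so that reversing [le] yields the theory of ideals. *)
Record half_algebra (T : Type) (le : T -> T -> Prop) (meet : T -> T -> T)
    (neg : T -> T) (top bot : T) : Prop := HalfAlgebra {
  half_refl : forall x, le x x;
  half_trans : forall y x z, le x y -> le y z -> le x z;
  half_meetl : forall x y, le (meet x y) x;
  half_meetr : forall x y, le (meet x y) y;
  half_meet_idem : forall x y, le (meet x y) (meet (meet x y) (meet x y));
  half_meet_monol : forall x y z, le x y -> le (meet x z) (meet y z);
  half_meet_monor : forall x y z, le x y -> le (meet z x) (meet z y);
  half_neg_anti : forall x y, le x y -> le (neg y) (neg x);
  half_neg_meet : forall x, le (neg (meet x x)) (neg x);
  half_meet_neg : forall x, le (meet x (neg x)) bot;
  half_negK : forall x y, le (neg (neg (meet x y))) (meet x y);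
  half_distr : forall x y z, le (meet x (neg (meet (neg y) (neg z))))
    (neg (meet (neg (meet x y)) (neg (meet x z))));
  half_bot : forall x, le bot x;
  half_top : forall x, le x top;
  half_top_neg : le (meet top top) (neg bot) }.

Record primary_filter (T : Type) (le : T -> T -> Prop) (meet : T -> T -> T)
    (neg : T -> T) (bot : T) (F : set T) : Prop := PrimaryFilter {
  primary_up : forall x y, le x y -> F x -> F y;
  primary_meet : forall x y, F x -> F y -> F (meet x y);
  primary_proper : ~ F bot;
  primary_or : forall x, F x \/ F (neg x) }.

Unset Implicit Arguments.

Section HalfAlgebra.
Context {T : Type} {le : T -> T -> Prop} {meet : T -> T -> T} {neg : T -> T}.
Context {top bot : T}.
Hypothesis half : half_algebra le meet neg top bot.

Let lexx := half_refl half.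
Let le_trans := half_trans half.
Let meetl := half_meetl half.
Let meetr := half_meetr half.
Let neg_anti := half_neg_anti half.

Local Notation primary := (primary_filter le meet neg bot).

Lemma meet_mono x y z t : le x y -> le z t -> le (meet x z) (meet y t).
Proof.
move=> xy zt; apply: le_trans (half_meet_monor half _ _ y zt).
exact: half_meet_monol half _ _ _ xy.
Qed.

(** An arbitrary [x] need not be below [meet x x], so [meet] computes greatest
    lower bounds only against lower bounds that are themselves meets. *)
Lemma meet_glb x y z t :
  le (meet x y) z -> le (meet x y) t -> le (meet x y) (meet z t).
Proof.
move=> xyz xyt; apply: le_trans (meet_mono _ _ _ _ xyz xyt).
exact: half_meet_idem half _ _.
Qed.

Lemma negneg_le x : le (neg (neg x)) x.
Proof.
apply: (le_trans (meet x x)) => //.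
apply: le_trans (half_negK half x x).
exact/neg_anti/(half_neg_meet half).
Qed.

(** For a meet [u], the element [w := meet (neg u) (neg u)] has
    [neg w] below [neg (neg u)], hence below [u]; so [neg u] is below
    [neg (neg w)], which is below [w] as [w] is a meet. Passing from [x] to
    [u := meet x x] does not change the negation. *)
Lemma neg_meet_idem x : le (neg x) (meet (neg x) (neg x)).
Proof.
have neg_u : le (neg x) (neg (meet x x)) by apply/neg_anti.
have neg_u' := half_neg_meet half x.
apply: le_trans (meet_mono _ _ _ _ neg_u' neg_u').
apply: le_trans neg_u _.
apply: le_trans (half_negK half _ _).
apply: neg_anti; apply: le_trans (half_neg_meet half _) _.
exact: half_negK half _ _.
Qed.

(** The Boolean join, which need not be above [x] and [y], is nevertheless
    below all their upper bounds. *)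
Lemma boolean_join_le x y z :
  le x z -> le y z -> le (neg (meet (neg x) (neg y))) z.
Proof.
move=> xz yz; apply: le_trans (negneg_le z); apply: neg_anti.
apply: le_trans (neg_meet_idem z) _.
by apply: meet_mono; apply: neg_anti.
Qed.

(** Only [meet top top] is below the excluded middle, as [top] need not be a
    meet. *)
Lemma excluded_middle x :
  le (meet top top) (neg (meet (neg x) (neg (neg x)))).
Proof.
apply: le_trans (half_top_neg half) _.
exact/neg_anti/(half_meet_neg half).
Qed.

Lemma meet_dichotomy f x z : le (meet f x) z -> le (meet f (neg x)) z ->
  le (meet f (meet top top)) z.
Proof.
move=> fx fnx; apply: le_trans (boolean_join_le _ _ _ fx fnx).
apply: le_trans (half_distr half f x (neg x)).
exact: meet_mono (lexx f) (excluded_middle x).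
Qed.

(** In a filter maximal among those avoiding [J], an element [x] outside it has
    a companion [f] in the filter with [meet f x] in [J]. If neither [x] nor
    [neg x] belonged to it, a common companion [f] and directedness of [J] would
    put [meet f (meet top top)] into [J] by [meet_dichotomy]. *)
Lemma primary_filter_separation (J : set T) (a : T) :
    (forall x y, le x y -> J y -> J x) ->
    (forall x y, J x -> J y -> exists z, [/\ J z, le x z & le y z]) ->
    J bot -> ~ J (meet a a) ->
  exists F, [/\ primary F, F a & forall x, F x -> ~ J x].
Proof.
move=> Jdown Jdir Jbot Jaa.
(* The empty set is admitted so that the empty chain has a union; the last
   clause forces every other member to contain [a]. *)
pose P := [set A : set T | [/\ forall x y, le x y -> A x -> A y,
  forall x y, A x -> A y -> A (meet x y), forall x, A x -> ~ J x &
  forall x, A x -> A a]].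
have [C CP Ctot|A [[Aup Ameet AJ Aa] Amax]] := @Zorn_bigcup T P.
  split.
  - move=> x y xy [X CX Xx]; exists X => //.
    by have [up _ _ _] := CP _ CX; apply: up xy Xx.
  - move=> x y [X CX Xx] [Y CY Yy].
    have [XY|YX] := Ctot X Y CX CY.
    + exists Y => //; have [_ meetY _ _] := CP _ CY.
      exact: meetY (XY _ Xx) Yy.
    + exists X => //; have [_ meetX _ _] := CP _ CX.
      exact: meetX Xx (YX _ Yy).
  - by move=> x [X CX Xx]; have [_ _ XJ _] := CP _ CX; apply: XJ.
  - move=> x [X CX Xx]; exists X => //.
    by have [_ _ _ Xa] := CP _ CX; apply: Xa Xx.
have {}Aa : A a.
  apply: contrapT => nAa.
  have A0 x : ~ A x by move=> /Aa.
  apply: (Amax [set z | le (meet a a) z]).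
    split=> [x /A0 //|sub].
    exact/(A0 (meet a a))/sub/lexx.
  split=> /=.
  - by move=> x y xy ax; apply: le_trans xy.
  - by move=> x y; apply: meet_glb.
  - by move=> x ax /(Jdown _ _ ax).
  - by move=> x _; apply: meetl.
have companion x : A x \/ exists2 f, A f & J (meet f x).
  case: (EM (A x)) => [|nAx]; [by left|right].
  apply: contrapT => noJ.
  apply: (Amax [set z | exists2 f, A f & le (meet f x) z]).
    split=> [z Az /=|sub]; first by exists z => //; apply: meetl.
    by apply/nAx/sub; exists a => //; apply: meetr.
  split=> /=.
  - by move=> y z yz [f Af fy]; exists f => //; apply: le_trans fy yz.
  - move=> y z [f Af fy] [g Ag gz]; exists (meet f g); first exact: Ameet.
    apply: meet_glb.
      by apply: le_trans fy; apply: meet_mono.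
    by apply: le_trans gz; apply: meet_mono.
  - by move=> z [f Af fz] Jz; apply: noJ; exists f => //; apply: Jdown Jz.
  - by move=> _ _; exists a => //; apply: meetl.
exists A; split=> //; split=> // [/AJ //|x].
have [Ax|[f Af Jf]] := companion x; first by left.
have [Anx|[g Ag Jg]] := companion (neg x); first by right.
have Atop : A top by apply: Aup Aa; apply: half_top half _.
have [z [Jz fz gz]] := Jdir _ _ Jf Jg.
exfalso; apply: (AJ (meet (meet f g) (meet top top))).
  by apply: (Ameet); apply: Ameet.
apply: Jdown Jz; apply: (meet_dichotomy _ x).
  by apply: le_trans fz; apply: meet_mono.
by apply: le_trans gz; apply: meet_mono.
Qed.

(** The elements below [b] are directed with bound [b] itself, so they can serve
    as the set to avoid. *)
Lemma le_of_primary_filters a b :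
  (forall F, primary F -> F a -> F b) -> le (meet a a) b.
Proof.
move=> Fab; apply: contrapT => nab.
have [||||F [pF Fa Fb]] := primary_filter_separation [set x | le x b] a => //=.
- by move=> x y; apply: le_trans.
- by move=> x y xb yb; exists b.
- exact: half_bot half _.
- exact: (Fb b (Fab _ pF Fa)) (lexx b).
Qed.

Section PrimaryFilter.
Variable F : set T.
Hypothesis pF : primary F.

Lemma primary_top : F top.
Proof.
have up := primary_up pF.
by have [] := primary_or pF top => //; apply: up; apply: half_top half _.
Qed.

Lemma primary_meetE x y : F (meet x y) <-> F x /\ F y.
Proof.
have up := primary_up pF.
split=> [Fxy|[Fx Fy]]; last exact: primary_meet pF _ _ Fx Fy.
by split; apply: up Fxy.
Qed.

Lemma primary_negE x : F (neg x) <-> ~ F x.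
Proof.
split=> [Fnx Fx|nFx]; last by have [] := primary_or pF x.
apply: (primary_proper pF).
apply: primary_up pF _ _ (half_meet_neg half x) _.
exact: primary_meet pF _ _ Fx Fnx.
Qed.

End PrimaryFilter.

End HalfAlgebra.

(** * The calculus as a double Boolean algebra *)

Lemma derivation_cat s t :
  cdbl_derivation s -> cdbl_derivation t -> cdbl_derivation (s ++ t).
Proof.
move=> ds dt i c; rewrite onth_cat; case: ltnP => [_|si] ci.
  have [|[ps rc psP]] := ds i c ci; [by left|right].
  exists ps => // p /psP[j ji jp]; exists j => //.
  by rewrite onth_cat -onthTE jp.
have [|[ps rc psP]] := dt _ c ci; [by left|right].
exists ps => // p /psP[j ji jp]; exists (size s + j).
  by rewrite -ltn_subRL.
by rewrite onth_cat ltnNge leq_addr /= addKn.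
Qed.

Lemma derivation_rcons s c : cdbl_derivation s ->
    cdbl_axiom c \/ (exists2 ps, cdbl_rule ps c &
      forall p, List.In p ps -> exists j, onth s j = Some p) ->
  cdbl_derivation (rcons s c).
Proof.
move=> ds dc i d; rewrite -cats1 onth_cat; case: ltnP => [_|si] ci.
  have [|[ps rc psP]] := ds i d ci; [by left|right].
  exists ps => // p /psP[j ji jp]; exists j => //.
  by rewrite onth_cat -onthTE jp.
move/onth1P: ci => [_ <-].
case: dc => [|[ps rc psP]]; [by left|right].
exists ps => // p /psP[j jp].
have js : j < size s by rewrite -onthTE jp.
by exists j; [apply: leq_trans si | rewrite onth_cat js].
Qed.

Lemma provable_axiom c : cdbl_axiom c -> provable c.
Proof.
move=> ac; exists [::]; apply: derivation_rcons; last by left.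
by move=> i d; rewrite onth0n.
Qed.

Lemma provable_rule ps c :
  cdbl_rule ps c -> (forall p, List.In p ps -> provable p) -> provable c.
Proof.
move=> rc pps.
suff [s ds sP] : exists2 s, cdbl_derivation s &
    forall p, List.In p ps -> exists j, onth s j = Some p.
  by exists s; apply: derivation_rcons => //; right; exists ps.
elim: ps pps {rc} => [|q ps IH] pps.
  by exists [::] => // i d; rewrite onth0n.
have [p pp|s ds sP] := IH; first by apply: pps; right.
have [t dt] : provable q by apply: pps; left.
exists (rcons t q ++ s); first exact: derivation_cat.
move=> p [<-|/sP[j jp]].
  exists (size t).
  by rewrite onth_cat size_rcons ltnSn -cats1 onth_cat ltnn subnn.
exists (size (rcons t q) + j).
by rewrite onth_cat ltnNge leq_addr /= addKn.
Qed.

Definition derivable (x y : formula) : Prop := provable (x ⊢ y).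

Lemma derivable_rule1 p c : cdbl_rule [:: p] c -> provable p -> provable c.
Proof. by move=> rc pp; apply: provable_rule rc _ => q [<-|[]]. Qed.

Lemma derivable_trans y x z : derivable x y -> derivable y z -> derivable x z.
Proof.
by move=> xy yz; apply: provable_rule (R4 x y z) _ => q [<-|[<-|[]]].
Qed.

Lemma meet_half : half_algebra derivable Meet Neg ⊤ ⊥.
Proof.
split; try by move=> *; apply: provable_axiom; constructor.
- exact: derivable_trans.
- by move=> x y z; apply: derivable_rule1; constructor.
- by move=> x y z; apply: derivable_rule1; constructor.
- by move=> x y; apply: derivable_rule1; constructor.
Qed.

Lemma join_half :
  half_algebra (fun x y => derivable y x) Join Opp ⊥ ⊤.
Proof.
split; try by move=> *; apply: provable_axiom; constructor.
- by move=> y x z xy yz; apply: derivable_trans yz xy.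
- by move=> x y z; apply: derivable_rule1; constructor.
- by move=> x y z; apply: derivable_rule1; constructor.
- by move=> x y; apply: derivable_rule1; constructor.
Qed.

(** * The canonical model *)

Definition formula_filter : set formula -> Prop :=
  primary_filter derivable Meet Neg ⊥.

Definition formula_ideal : set formula -> Prop :=
  primary_filter (fun x y => derivable y x) Join Opp ⊤.

(** The carriers are subtypes of [formula -> Prop] rather than of [set formula],
    which would force the universe of contexts too high. *)
Definition canonical_context : context :=
  @Context {F : formula -> Prop | formula_filter F}
    {I : formula -> Prop | formula_ideal I}
    (fun F I => exists2 x, sval F x & sval I x).

Definition filters_of (x : formula) : set (object canonical_context) :=
  [set F | sval F x].

Definition ideals_of (x : formula) : set (attribute canonical_context) :=
  [set I | sval I x].

(** An ideal that omits [x ⊓ x] is a directed lower set, the join being the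
    upper bound, so some primary filter containing [x] avoids it. *)
Lemma common_attributes_filters_of x :
  common_attributes (filters_of x) = ideals_of (x ⊓ x).
Proof.
apply/seteqP; split=> -[I pI] /= HI; last first.
  move=> [F pF] Fx; exists (x ⊓ x) => //=.
  by apply/(primary_meetE meet_half _ pF); split.
apply: contrapT => nI.
have [||||F [pF Fx FI]] := primary_filter_separation meet_half I x => //.
- by move=> y z yz; apply: primary_up pI _ _ yz.
- move=> y z Iy Iz; exists (y ⊔ z); split.
  + exact: primary_meet pI _ _ Iy Iz.
  + exact: half_meetl join_half y z.
  + exact: half_meetr join_half y z.
- exact: primary_top join_half _ pI.
- by have [y /FI] := HI (exist _ F pF) Fx.
Qed.

(** The mirror image: a filter that omits [x ⊔ x] is directed downwards by
    meets, so some primary ideal containing [x] avoids it. *)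
Lemma common_objects_ideals_of x :
  common_objects (ideals_of x) = filters_of (x ⊔ x).
Proof.
apply/seteqP; split=> -[F pF] /= HF; last first.
  move=> [I pI] Ix; exists (x ⊔ x) => //=.
  by apply/(primary_meetE join_half _ pI); split.
apply: contrapT => nF.
have [||||I [pI Ix IF]] := primary_filter_separation join_half F x => //.
- by move=> y z yz; apply: primary_up pF _ _ yz.
- move=> y z Fy Fz; exists (y ⊓ z); split.
  + exact: primary_meet pF _ _ Fy Fz.
  + exact: half_meetl meet_half y z.
  + exact: half_meetr meet_half y z.
- exact: primary_top meet_half _ pF.
- by have [y Fy /IF] := HF (exist _ I pI) Ix.
Qed.

Lemma filters_of_mono x y : derivable x y -> filters_of x `<=` filters_of y.
Proof. by move=> xy [F pF]; apply: primary_up pF _ _ xy. Qed.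

Lemma ideals_of_mono x y : derivable x y -> ideals_of y `<=` ideals_of x.
Proof. by move=> xy [I pI]; apply: primary_up pI _ _ xy. Qed.

(** Both sides are filter sets: of [(x ⊓ x) ⊔ (x ⊓ x)] on the left, and on the
    right of [x ⊔ x], that is, of [(x ⊔ x) ⊓ (x ⊔ x)]. Axiom (14) identifies
    these. *)
Lemma canonical_protoconceptP x :
  common_objects (common_attributes (filters_of x)) =
  common_objects (ideals_of x).
Proof.
rewrite common_attributes_filters_of !common_objects_ideals_of.
apply/seteqP; split=> F.
  move=> /(filters_of_mono _ _ (provable_axiom _ (ax14_r x))).
  exact/filters_of_mono/(half_meetl meet_half).
move=> Fx; apply/(filters_of_mono _ _ (provable_axiom _ (ax14_l x))).
by case: F Fx => F pF Fx; apply/(primary_meetE meet_half _ pF).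
Qed.

Definition canonical_protoconcept (x : formula) :
    protoconcept canonical_context :=
  Protoconcept (canonical_protoconceptP x).

Lemma protoconcept_ext K (p q : protoconcept K) :
  extent p = extent q -> intent p = intent q -> p = q.
Proof.
case: p q => A B AB [C D CD] /= eAC eBD; case: _ / eAC in CD *.
by case: _ / eBD in CD *; congr Protoconcept; apply: Prop_irrelevance.
Qed.

(** The operations [pc_meet] and [pc_neg] return the protoconcept generated by
    an extent, so their intents are derived from it. This matches the canonical
    intent of [x] only if [x] is idempotent for [⊓]. *)
Lemma canonical_of_objects x A : derivable x (x ⊓ x) -> filters_of x = A ->
  canonical_protoconcept x = pc_of_objects A.
Proof.
move=> xx <-; apply: protoconcept_ext => //=.
rewrite common_attributes_filters_of.
apply/seteqP; split; apply: ideals_of_mono => //.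
exact: half_meetl meet_half _ _.
Qed.

Lemma canonical_of_attributes x B : derivable (x ⊔ x) x -> ideals_of x = B ->
  canonical_protoconcept x = pc_of_attributes B.
Proof.
move=> xx <-; apply: protoconcept_ext => //=.
rewrite common_objects_ideals_of.
apply/seteqP; split; apply: filters_of_mono => //.
exact: half_meetl join_half _ _.
Qed.

Lemma canonical_meet x y : canonical_protoconcept (x ⊓ y) =
  pc_meet (canonical_protoconcept x) (canonical_protoconcept y).
Proof.
apply: canonical_of_objects; first exact: half_meet_idem meet_half _ _.
by apply/seteqP; split=> -[F pF] /(primary_meetE meet_half _ pF).
Qed.

Lemma canonical_join x y : canonical_protoconcept (x ⊔ y) =
  pc_join (canonical_protoconcept x) (canonical_protoconcept y).
Proof.
apply: canonical_of_attributes; first exact: half_meet_idem join_half _ _.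
by apply/seteqP; split=> -[I pI] /(primary_meetE join_half _ pI).
Qed.

Lemma canonical_neg x :
  canonical_protoconcept (¬ x) = pc_neg (canonical_protoconcept x).
Proof.
apply: canonical_of_objects; first exact: neg_meet_idem meet_half _.
by apply/seteqP; split=> -[F pF] /(primary_negE meet_half _ pF).
Qed.

Lemma canonical_opp x :
  canonical_protoconcept (⌟ x) = pc_opp (canonical_protoconcept x).
Proof.
apply: canonical_of_attributes; first exact: neg_meet_idem join_half _.
by apply/seteqP; split=> -[I pI] /(primary_negE join_half _ pI).
Qed.

Lemma canonical_top : canonical_protoconcept ⊤ = pc_top canonical_context.
Proof.
apply: protoconcept_ext; apply/seteqP; split=> //= -[F pF] //=.
- by move=> _; apply: primary_top meet_half _ pF.
- exact: primary_proper pF.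
Qed.

Lemma canonical_bot : canonical_protoconcept ⊥ = pc_bot canonical_context.
Proof.
apply: protoconcept_ext; apply/seteqP; split=> //= -[F pF] //=.
- exact: primary_proper pF.
- by move=> _; apply: primary_top join_half _ pF.
Qed.

Definition canonical_valuation : valuation canonical_context :=
  Valuation canonical_join canonical_meet canonical_neg canonical_opp
    canonical_top canonical_bot.

(** Of the four premises of (R5), two hold by idempotence of meets and joins;
    the other two say [a ⊓ a ⊢ b] and [a ⊢ b ⊔ b]. *)
Lemma derivable_of_halves a b :
  derivable (a ⊓ a) b -> derivable a (b ⊔ b) -> derivable a b.
Proof.
move=> aab abb; apply: provable_rule (R5 a b) _ => p.
have meetl := half_meetl meet_half.
have joinr := half_meetr join_half.
case=> [<-|[<-|[<-|[<-|[]]]]].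
- exact: (meet_glb meet_half _ _ _ _ (meetl a b) (meetl a b)).
- exact: (meet_glb meet_half _ _ _ _ (meetl a a) aab).
- exact: (meet_glb join_half b b a b abb (joinr b b)).
- exact: (meet_glb join_half a b b b (joinr a b) (joinr a b)).
Qed.

Theorem theorem34 (a b : formula) :
  valid_in [set: context] (a ⊢ b) -> provable (a ⊢ b).
Proof.
move=> /(_ canonical_context I canonical_valuation)[/= Fab Iba].
apply: derivable_of_halves.
  apply: (le_of_primary_filters meet_half) => F pF.
  exact: Fab (exist _ F pF).
apply: (le_of_primary_filters join_half) => J pJ.
exact: Iba (exist _ J pJ).
Qed.
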